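(* Let $d=2^r$ for some integer $r\ge 2$, let $t_1<t_2<\dots<t_{d+1}$ be real numbers, and let $f:[t_1,t_{d+1}]\to\mathbb{R}$ be a lower semi-continuous univariate piecewise linear function with $f(x)=a_1x+b_1$ for $t_1\le x\le t_2$ and $f(x)=a_ix+b_i$ for $t_i<x\le t_{i+1}$, $i=2,\dots,d$. Let $\kappa$ and the family $\mathcal{T}=(T^i)_{i=1}^d$ of subsets of $V=\{1,\dots,d+1+\kappa\}$ be those associated with $f$ (see context). Assume that $f$ is continuous on the interval $[t_{d/4+1},t_{d/2+1}]$, inclusive of the endpoints (i.e. $f$ is continuous at every point of this closed interval). Let the encoding $H=(h^i)_{i=1}^d$ be either the binary reflected Gray encoding $H^{\mathrm{br}}_d$ or the zig-zag encoding $H^{\mathrm{zz}}_d$. Then $(\lambda,z)\in Q(\mathcal{T},H)$ if and only if $$\sum_{v=1}^{d+1+\kappa}\lambda_v\min_{s\,:\,v\in T^s}h^s_k\ \le\ z_k\ \le\ \sum_{v=1}^{d+1+\kappa}\lambda_v\max_{s\,:\,v\in T^s}h^s_k\qquad\text{for all }k\in\{1,\dots,r\},$$ $$(\lambda,z)\in\Delta^{d+1+\kappa}\times\mathbb{R}^r.$$ Moreover, the same equivalence holds if the continuity assumption is replaced by the assumption that $f$ is continuous on the interval $[t_{d/2+1},t_{3d/4+1}]$, inclusive of the endpoints.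
   Context: Notation. $\Delta^N=\{\lambda\in\mathbb{R}^N_{\ge0}:\sum_v\lambda_v=1\}$. For $T\subseteq\{1,\dots,N\}$, $P(T)=\{\lambda\in\Delta^N:\lambda_v\ne0\text{ only if }v\in T\}$. For a family $\mathcal{T}=(T^i)_{i=1}^d$ of subsets of $\{1,\dots,N\}$ and an encoding $H=(h^i)_{i=1}^d$ (pairwise distinct vectors in $\mathbb{R}^r$), $Q(\mathcal{T},H)=\operatorname{Conv}\big(\bigcup_{i=1}^d(P(T^i)\times\{h^i\})\big)\subseteq\mathbb{R}^N\times\mathbb{R}^r$. $h^s_k$ is the $k$-th component of $h^s$. Family of sets attached to $f$. A breakpoint index $i\in\{1,\dots,d-1\}$ is discontinuous if $a_it_{i+1}+b_i\ne a_{i+1}t_{i+1}+b_{i+1}$; $\kappa$ is the number of discontinuous breakpoint indices. Let $T^i=\{(t_i,a_it_i+b_i),(t_{i+1},a_it_{i+1}+b_i)\}\subset\mathbb{R}^2$ for $i=1,\dots,d$. The ground set $\bigcup_{i=1}^dT^i$ has $d+1+\kappa$ elements and is identified with $V=\{1,\dots,d+1+\kappa\}$ by numbering the points in the order in which they are met when listing, for $i=1,\dots,d$, the left endpoint and then the right endpoint of piece $i$ (a point shared by two consecutive pieces is counted once). Equivalently, $T^i=\{i+\kappa_i,\,i+1+\kappa_i\}$, where $\kappa_i$ is the number of discontinuous indices $j<i$. Encodings. Define $K^s\in\{0,1\}^{2^s\times s}$ and $C^s\in\mathbb{Z}^{2^s\times s}$ recursively by $K^1=C^1=(0,1)^T$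 and $$K^{s+1}=\begin{pmatrix}K^s&\mathbf{0}\\ \operatorname{rev}(K^s)&\mathbf{1}\end{pmatrix},\qquad C^{s+1}=\begin{pmatrix}C^s&\mathbf{0}\\ C^s+\mathbf{1}\otimes C^s_{2^s}&\mathbf{1}\end{pmatrix},$$ where $\mathbf{0},\mathbf{1}$ are the all-zeros and all-ones column vectors of length $2^s$, $\operatorname{rev}(A)$ reverses the order of the rows of $A$, $A_i$ is the $i$-th row of $A$, and $u\otimes v=uv^T$ (so the last row $C^s_{2^s}$ is added to every row of $C^s$). For $d=2^r$, $H^{\mathrm{br}}_d=(K^r_i)_{i=1}^d$ and $H^{\mathrm{zz}}_d=(C^r_i)_{i=1}^d$ are the sequences of rows of $K^r$ and $C^r$. *)

(* Defs.v *)
From mathcomp Require Import all_boot all_order all_algebra.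
From mathcomp Require Import all_classical all_reals all_analysis.
Import Order.TTheory GRing.Theory Num.Theory.
Import numFieldNormedType.Exports.

Set Implicit Arguments.
Unset Strict Implicit.
Unset Printing Implicit Defensive.

Local Open Scope classical_set_scope.
Local Open Scope ring_scope.

(* Indices start at 0: [t : 'I_d.+1 -> R] lists t_1, ..., t_(d+1), and          *)
(* [a b : 'I_d -> R], [T : 'I_d -> _] and the rows of [H : 'M_(d, r)] list the  *)
(* data of the pieces 1, ..., d.                                                *)

Section Simplex.
Variables (R : realType) (N : nat).

Definition simplex : set 'rV[R]_N :=
  [set l | (forall v, 0 <= l 0 v) /\ \sum_v l 0 v = 1].

Definition face (T : {set 'I_N}) : set 'rV[R]_N :=
  [set l | simplex l /\ forall v, l 0 v != 0 -> v \in T].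

End Simplex.

Definition convex_hull (R : realType) (M : lmodType R) (A : set M) : set M :=
  smallest (@convex_set R M) A.

Definition embedding (R : realType) (N d r : nat) (T : 'I_d -> {set 'I_N})
    (H : 'M[R]_(d, r)) : set ('rV[R]_N * 'rV[R]_r)%type :=
  convex_hull (\bigcup_(i in [set: 'I_d]) (face (T i) `*` [set row i H])).

(* The default value 0 is returned only when [P] is empty. *)
Definition min_over (R : realType) (I : finType) (P : pred I) (F : I -> R) : R :=
  if [pick i | P i] is Some i0 then F [arg min_(i < i0 | P i) F i]%O else 0.

Definition max_over (R : realType) (I : finType) (P : pred I) (F : I -> R) : R :=
  if [pick i | P i] is Some i0 then F [arg max_(i > i0 | P i) F i]%O else 0.

Section Pieces.
Variables (R : realType) (d : nat) (t : 'I_d.+1 -> R) (a b : 'I_d -> R).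

Definition tleft (i : 'I_d) : R := t (widen_ord (leqnSn d) i).
Definition tright (i : 'I_d) : R := t (lift ord0 i).

Definition lpoint (i : 'I_d) : R * R := (tleft i, a i * tleft i + b i).
Definition rpoint (i : 'I_d) : R * R := (tright i, a i * tright i + b i).

(* The breakpoint at the right end of piece [i]; false for the last piece. *)
Definition discontinuous (i : 'I_d) : bool :=
  [exists j : 'I_d, (j == i.+1 :> nat)
    && (a i * tright i + b i != a j * tleft j + b j)].

Definition kappa : nat := #|[pred i | discontinuous i]|.

(* Only consecutive entries of the listing can coincide, so it does not matter  *)
(* that [undup] keeps the last copy of each point.                              *)
Definition points : seq (R * R) :=
  undup (flatten [seq [:: lpoint i; rpoint i] | i <- enum 'I_d]).

Definition piece_set (i : 'I_d) : {set 'I_(d + 1 + kappa)} :=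
  [set v : 'I_(d + 1 + kappa) | (v == index (lpoint i) points :> nat)
        || (v == index (rpoint i) points :> nat)].

Definition piecewise_linear (f : R -> R) : Prop :=
  (forall (i : 'I_d) x, tleft i < x <= tright i -> f x = a i * x + b i) /\
  (forall (i : 'I_d) x, i = 0%N :> nat ->
     tleft i <= x <= tright i -> f x = a i * x + b i).

(* Lower semi-continuity of the restriction of [f] to [t_1, t_(d+1)]. *)
Definition lsc_on_domain (f : R -> R) : Prop :=
  lower_semicontinuous
    (fun x : subspace [set` `[t ord0, t ord_max]] => (f x)%:E).

End Pieces.

Section Encodings.
Variable R : nzRingType.

Lemma expn2S s : (2 ^ s + 2 ^ s = 2 ^ s.+1)%N.
Proof. by rewrite addnn -mul2n expnS. Qed.

Lemma last_row_subproof s : ((2 ^ s).-1 < 2 ^ s)%N.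
Proof. by rewrite ltn_predL expn_gt0. Qed.

Definition last_row s : 'I_(2 ^ s) := Ordinal (last_row_subproof s).

(* The recursions start from the 1 x 0 matrix at s = 0, which gives the         *)
(* column (0, 1)^T at s = 1.                                                    *)
Fixpoint reflected_gray (s : nat) : 'M[R]_(2 ^ s, s) :=
  match s return 'M[R]_(2 ^ s, s) with
  | 0%N => const_mx 0
  | s'.+1 =>
      castmx (expn2S s', addn1 s')
        (block_mx (reflected_gray s')                        (const_mx 0)
                  (rowsub (@rev_ord _) (reflected_gray s'))  (const_mx 1))
  end.

Fixpoint zigzag (s : nat) : 'M[R]_(2 ^ s, s) :=
  match s return 'M[R]_(2 ^ s, s) with
  | 0%N => const_mx 0
  | s'.+1 =>
      let C := zigzag s' in
      castmx (expn2S s', addn1 s')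
        (block_mx C                                            (const_mx 0)
                  (C + const_mx 1 *m row (last_row s') C)      (const_mx 1))
  end.

End Encodings.

(* Main.v *)
Require Import Defs.
From mathcomp Require Import all_boot all_order all_algebra.
From mathcomp Require Import all_classical all_reals all_analysis.
From mathcomp Require Import ring lra.
Import Order.TTheory GRing.Theory Num.Theory.
Import numFieldNormedType.Exports.

Set Implicit Arguments.
Unset Strict Implicit.
Unset Printing Implicit Defensive.

Local Open Scope classical_set_scope.
Local Open Scope ring_scope.

(** A point of the embedding splits the mass [lambda 0 v] of each vertex [v] among
    the codes of the pieces that contain [v].  For a fixed [lambda], the admissible
    [z] therefore form the Minkowski sum over [v] of the polytopes
    [Conv {h^s | v \in T^s}] scaled by [lambda 0 v].

    A vertex of a piecewise linear function lies in a single piece or in two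
    consecutive ones ([piece_set_adjacent]), and consecutive rows of both encodings
    differ in one coordinate only ([unit_steps_reflected_gray],
    [unit_steps_zigzag]).  So each of these polytopes is a point or a segment
    parallel to a coordinate axis, and a Minkowski sum of axis-parallel segments is
    the box whose lower and upper corners are the sums of those of the summands.
    This is [embedding_eq_box], which asks of the family and the encoding only that
    the codes at each vertex lie on an axis-parallel line and that the family cover
    the vertices.

    Covering matters because the embedding gives weight 0 to a vertex outside all
    pieces, whereas the box does not.  For the pieces of a function it says that the
    listing of endpoints has at least [d + 1 + kappa] distinct points
    ([leq_size_points]). *)

(** * Convex sets and extrema over finite types *)

Lemma convex_set_conv (R : realType) (M : lmodType R) (A : set M) (p : R) x y :
  convex_set (A : set (convex_lmodType M)) -> 0 <= p <= 1 -> A x -> A y ->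
  A (p *: x + (1 - p) *: y).
Proof.
move=> cA /andP[p0 p1] Ax Ay.
by have := cA x y (Itv01 p0 p1) (mem_set Ax) (mem_set Ay); rewrite inE.
Qed.

Lemma convex_hull_convex (R : realType) (M : lmodType R) (A : set M) :
  convex_set (convex_hull A : set (convex_lmodType M)).
Proof.
move=> x y p; rewrite !inE => Ax Ay B [cB AB].
have := cB x y p (mem_set (Ax B (conj cB AB))) (mem_set (Ay B (conj cB AB))).
by rewrite inE.
Qed.

Lemma convex_set_sum (R : realType) (M : lmodType R) (A : set M) (I : finType)
    (w : I -> R) (x : I -> M) :
  convex_set (A : set (convex_lmodType M)) ->
  (forall i, 0 <= w i) -> \sum_i w i = 1 -> (forall i, A (x i)) ->
  A (\sum_i w i *: x i).
Proof.
move=> cA w0 w1 Ax.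
(* The weight not yet handed out sits on a single point [y] of [A], which absorbs *)
(* the points of the family one at a time; the weights stay normalised.           *)
have partial (s : seq I) y : A y -> \sum_(i <- s) w i <= 1 ->
    A (\sum_(i <- s) w i *: x i + (1 - \sum_(i <- s) w i) *: y).
  elim: s y => [|i s IH] y Ay.
    by rewrite !big_nil subr0 scale1r add0r.
  rewrite !big_cons; set W := \sum_(j <- s) w j => leW1.
  have [u0|u0] := eqVneq (1 - W) 0.
    have wi0 : w i = 0 by apply/eqP; rewrite eq_le w0 andbT; lra.
    by rewrite wi0 scale0r !add0r; apply: IH => //; rewrite -/W; lra.
  have wi0 := w0 i.
  have u_gt0 : 0 < 1 - W by rewrite lt_neqAle eq_sym u0; lra.
  have py : A ((w i / (1 - W)) *: x i + (1 - w i / (1 - W)) *: y).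
    apply: convex_set_conv => //; rewrite divr_ge0 ?(ltW u_gt0) //=.
    by rewrite ler_pdivrMr // mul1r; lra.
  have := IH _ py; rewrite -/W => /(_ ltac:(lra)).
  rewrite scalerDr !scalerA mulrBr mulr1 [_ * (w i / _)]mulrC divfK //.
  by congr (A _); rewrite addrCA !addrA; congr (_ + _ *: _); ring.
have [i _|noI] := pickP (fun _ : I => true).
  have := partial (index_enum I) (x i) (Ax i).
  by rewrite w1 subrr scale0r addr0; apply.
by move/eqP: w1; rewrite big_pred0 // eq_sym oner_eq0.
Qed.

Lemma min_overP (R : realType) (I : finType) (P : pred I) (F : I -> R) i :
  P i -> exists j, [/\ P j, min_over P F = F j & forall m, P m -> F j <= F m].
Proof.
rewrite /min_over => Pi; case: pickP => [i0 Pi0|/(_ i)]; last by rewrite Pi.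
by case: arg_minP => // j Pj minj; exists j.
Qed.

Lemma max_overP (R : realType) (I : finType) (P : pred I) (F : I -> R) i :
  P i -> exists j, [/\ P j, max_over P F = F j & forall m, P m -> F m <= F j].
Proof.
rewrite /max_over => Pi; case: pickP => [i0 Pi0|/(_ i)]; last by rewrite Pi.
by case: arg_maxP => // j Pj maxj; exists j.
Qed.

Lemma between_conv (R : realType) (lo x hi : R) : lo <= x <= hi ->
  exists p, 0 <= p <= 1 /\ x = p * lo + (1 - p) * hi.
Proof.
move=> /andP[lox xhi]; have [e|ne] := eqVneq lo hi.
  by exists 0; split; [rewrite lexx ler01|lra].
have gap : 0 < hi - lo by rewrite subr_gt0 lt_neqAle ne (le_trans lox).
exists ((hi - x) / (hi - lo)); split; last by field; rewrite gt_eqF.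
by rewrite divr_ge0 ?subr_ge0 ?(le_trans lox) //= ler_pdivrMr // mul1r; lra.
Qed.

(** * The embedding of axis-parallel codes is a box *)

Section Box.
Variables (R : realType) (N d r : nat).
Variables (T : 'I_d -> {set 'I_N}) (H : 'M[R]_(d, r)).

Definition lower (v : 'I_N) (k : 'I_r) : R :=
  min_over (fun s => v \in T s) (fun s => H s k).
Definition upper (v : 'I_N) (k : 'I_r) : R :=
  max_over (fun s => v \in T s) (fun s => H s k).

Definition box : set ('rV[R]_N * 'rV[R]_r)%type :=
  [set x : 'rV[R]_N * 'rV[R]_r |
    (forall k, \sum_v x.1 0 v * lower v k <= x.2 0 k
               <= \sum_v x.1 0 v * upper v k) /\ simplex x.1].

Lemma sum_conv (x y c : 'I_N -> R) p :
  \sum_v (p * x v + (1 - p) * y v) * c v =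
  p * (\sum_v x v * c v) + (1 - p) * (\sum_v y v * c v).
Proof.
by rewrite !mulr_sumr -big_split /=; apply: eq_bigr => v _; ring.
Qed.

Lemma box_convex :
  convex_set (box : set (convex_lmodType ('rV[R]_N * 'rV[R]_r)%type)).
Proof.
move=> x y p; rewrite !inE => -[xb [x0 x1]] [yb [y0 y1]].
have p0 : 0 <= p%:num by [].
have p1 : 0 <= 1 - p%:num by rewrite subr_ge0.
have E v : (p%:num *: x.1 + (1 - p%:num) *: y.1) 0 v =
    p%:num * x.1 0 v + (1 - p%:num) * y.1 0 v by rewrite !mxE.
have S c : \sum_v (p%:num *: x.1 + (1 - p%:num) *: y.1) 0 v * c v =
    p%:num * (\sum_v x.1 0 v * c v) + (1 - p%:num) * (\sum_v y.1 0 v * c v).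
  by rewrite -sum_conv; apply: eq_bigr => v _; rewrite E.
suff : box (p%:num *: x.1 + (1 - p%:num) *: y.1,
            p%:num *: x.2 + (1 - p%:num) *: y.2) by [].
split; [|split] => /=.
- move=> k; rewrite !S !mxE.
  have /andP[xl xu] := xb k; have /andP[yl yu] := yb k.
  by rewrite !lerD // ler_wpM2l.
- by move=> v; rewrite E addr_ge0 // mulr_ge0.
- rewrite (eq_bigr _ (fun v _ => E v)) big_split /= -!mulr_sumr x1 y1.
  by rewrite !mulr1 addrC subrK.
Qed.

(** The bounds are averages of [lower v k] and [upper v k] weighted by [l], and only
    vertices of the piece [i] carry weight. *)
Lemma face_row_box i l : face (T i) l -> box (l, row i H).
Proof.
move=> [l_simplex l_supp]; split => //= k; rewrite mxE.
have [l0 l1] := l_simplex.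
rewrite -[H i k]mul1r -l1 mulr_suml; apply/andP.
split; apply: ler_sum => v _; have [->|lv] := eqVneq (l 0 v) 0;
  rewrite ?mul0r // ler_wpM2l //; have vT := l_supp v lv.
- have [j [_ E minj]] := min_overP (P := fun s => v \in T s) (H ^~ k) vT.
  by rewrite /lower E minj.
- have [j [_ E maxj]] := max_overP (P := fun s => v \in T s) (H ^~ k) vT.
  by rewrite /upper E maxj.
Qed.

Hypothesis cover : forall v, exists s, v \in T s.
Hypothesis parallel : forall v, exists k0, forall s s' k,
  v \in T s -> v \in T s' -> k != k0 -> H s k = H s' k.

(** One parameter [p k] per coordinate, shared by all vertices, is enough: the codes
    at [v] vary along the axis [k0] only, so [p k0] places the point on the segment
    between the codes that are extreme in this direction, and in every other
    coordinate the two bounds coincide. *)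
Lemma vertex_in_embedding (p : 'I_r -> R) v : (forall k, 0 <= p k <= 1) ->
  embedding T H
    (delta_mx 0 v, \row_k (p k * lower v k + (1 - p k) * upper v k)).
Proof.
move=> p01; have [k0 par] := parallel v; have [s vs] := cover v.
have gen i : v \in T i -> embedding T H (delta_mx 0 v, row i H).
  move=> vi; apply: sub_gen_smallest; exists i => //; split => //; split.
    split=> [u|]; first by rewrite mxE ler0n.
    rewrite (bigD1 v) //= mxE !eqxx big1 ?addr0 // => u uv.
    by rewrite mxE eqxx (negPf uv).
  by move=> u; rewrite mxE eqxx; case: (eqVneq u v) => [->|]; rewrite ?eqxx.
have [i [vi Ei _]] := min_overP (P := fun s => v \in T s) (H ^~ k0) vs.
have [j [vj Ej _]] := max_overP (P := fun s => v \in T s) (H ^~ k0) vs.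
have := convex_set_conv (@convex_hull_convex _ _ _) (p01 k0) (gen i vi) (gen j vj).
congr (embedding _ _ (_, _)).
  by rewrite -scalerDl addrC subrK scale1r.
apply/rowP => k; rewrite !mxE.
have [->|kk0] := eqVneq k k0; first by rewrite /lower /upper Ei Ej.
rewrite /lower /upper.
have [i' [vi' -> _]] := min_overP (P := fun s => v \in T s) (H ^~ k) vs.
have [j' [vj' -> _]] := max_overP (P := fun s => v \in T s) (H ^~ k) vs.
rewrite (par i s) // (par j s) // (par i' s) // (par j' s) //; ring.
Qed.

Theorem embedding_eq_box : embedding T H = box.
Proof.
apply/seteqP; split=> [|[l z] [/= zb [l0 l1]]].
  apply: smallest_sub; first exact: box_convex.
  by move=> [l z] [i _ [/= fl ->]]; exact: face_row_box.
(* Each [z 0 k] divides its interval in some ratio [p k]; dividing the coordinate *)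
(* ranges of all vertices in this same ratio gives points that average to [z].    *)
have /choice[p pP] k := between_conv (zb k).
have := convex_set_sum (@convex_hull_convex _ _ _) l0 l1
  (fun v => vertex_in_embedding v (fun k => (pP k).1)).
congr (embedding _ _ _); rewrite [LHS]surjective_pairing; congr (_, _).
  rewrite (raddf_sum fst) /= [RHS]row_sum_delta; exact: eq_bigr.
apply/rowP => k; rewrite (raddf_sum snd) summxE (pP k).2.
rewrite !mulr_sumr -big_split; apply: eq_bigr => v _ /=.
by rewrite !mxE /=; ring.
Qed.

End Box.

(** * Consecutive rows of the encodings *)

Definition unit_steps (R : realType) m n (A : 'M[R]_(m, n)) :=
  forall i j : 'I_m, j = i.+1 :> nat ->
  exists k0, forall k, k != k0 -> A i k = A j k.

Lemma unit_steps_castmx (R : realType) m n m' n' (e : (m = m') * (n = n'))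
    (A : 'M[R]_(m, n)) : unit_steps A -> unit_steps (castmx e A).
Proof. by case: e => em en; case: m' / em; case: n' / en. Qed.

(** Inside a half the appended coordinate is constant, and at the junction it is the
    only one to change. *)
Lemma unit_steps_block (R : realType) m n (A B : 'M[R]_(m, n)) :
  unit_steps A -> unit_steps B ->
  (forall i j : 'I_m, i.+1 = m -> j = 0%N :> nat -> row i A = row j B) ->
  unit_steps (block_mx A (const_mx 0) B (const_mx 1) : 'M[R]_(m + m, n + 1)).
Proof.
move=> sA sB glue i j; case: (splitP i) => i' Ei; case: (splitP j) => j' Ej.
- have {Ei}-> : i = lshift m i' by apply: val_inj.
  have {Ej}-> : j = lshift m j' by apply: val_inj.
  move=> /sA[k0 k0P]; exists (lshift 1 k0) => k.
  case: (splitP k) => k' Ek.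
    have {Ek}-> : k = lshift 1 k' by apply: val_inj.
    by rewrite !block_mxEul (inj_eq (@lshift_inj _ _)); exact: k0P.
  have {Ek}-> : k = rshift n k' by apply: val_inj.
  by rewrite !block_mxEur !mxE.
- rewrite {1}Ei {1}Ej => ij; have ltim := ltn_ord i'.
  have im : i'.+1 = m by apply/eqP; rewrite eqn_leq ltim -ij leq_addr.
  have j0 : j' = 0%N :> nat by apply/eqP; rewrite -(eqn_add2l m) addn0 ij im.
  have {Ei ij}-> : i = lshift m i' by apply: val_inj.
  have {Ej}-> : j = rshift m j' by apply: val_inj.
  exists (rshift n ord0) => k.
  case: (splitP k) => k' Ek.
    have {Ek}-> : k = lshift 1 k' by apply: val_inj.
    rewrite block_mxEul block_mxEdl => _.
    by have /rowP/(_ k') := glue _ _ im j0; rewrite !mxE.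
  have {Ek}-> : k = rshift n k' by apply: val_inj.
  by rewrite (ord1 k') eqxx.
- by rewrite Ei Ej => E; have := ltn_ord j'; rewrite E ltnNge -addnS leq_addr.
- rewrite {1}Ei {1}Ej -addnS => /addnI/sB[k0 k0P].
  have {Ei}-> : i = rshift m i' by apply: val_inj.
  have {Ej}-> : j = rshift m j' by apply: val_inj.
  exists (lshift 1 k0) => k.
  case: (splitP k) => k' Ek.
    have {Ek}-> : k = lshift 1 k' by apply: val_inj.
    by rewrite !block_mxEdl (inj_eq (@lshift_inj _ _)); exact: k0P.
  have {Ek}-> : k = rshift n k' by apply: val_inj.
  by rewrite !block_mxEdr !mxE.
Qed.

Lemma unit_steps_reflected_gray (R : realType) s :
  unit_steps (reflected_gray R s).
Proof.
elim: s => [|s IH]; first by move=> i j; rewrite (ord1 i) (ord1 j).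
apply/unit_steps_castmx/unit_steps_block => //.
- move=> i j ij; have /IH[k0 k0P] : rev_ord i = (rev_ord j).+1 :> nat.
    by rewrite /= ij subnSK // -ij.
  by exists k0 => k /k0P E; rewrite !mxE.
- move=> i j im j0; rewrite row_rowsub; congr (row _ _).
  by apply: val_inj; rewrite /= j0 subn1; exact: (congr1 predn im).
Qed.

(** This is why the zig-zag halves fit together: the last row of the first one is
    added to every row of the second one, which therefore starts from it. *)
Lemma zigzag_first_row (R : nzRingType) s (i : 'I_(2 ^ s)) :
  i = 0%N :> nat -> row i (zigzag R s) = 0.
Proof.
elim: s i => [|s IH] i i0; first by apply/rowP => k; rewrite !mxE.
have pos : (0 < 2 ^ s)%N by rewrite expn_gt0.
apply/rowP => k; rewrite mxE castmxE.
have -> : cast_ord (esym (expn2S s)) i = lshift _ (Ordinal pos).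
  exact: val_inj.
set k1 := cast_ord _ k; case: (splitP k1) => k' Ek.
  have -> : k1 = lshift 1 k' by apply: val_inj.
  by have /rowP/(_ k') := IH (Ordinal pos) erefl; rewrite block_mxEul !mxE.
have -> : k1 = rshift s k' by apply: val_inj.
by rewrite block_mxEur !mxE.
Qed.

Lemma unit_steps_zigzag (R : realType) s : unit_steps (zigzag R s).
Proof.
elim: s => [|s IH]; first by move=> i j; rewrite (ord1 i) (ord1 j).
apply/unit_steps_castmx/unit_steps_block => //.
- move=> i j /IH[k0 k0P]; exists k0 => k /k0P E.
  rewrite [LHS]mxE [RHS]mxE E !mxE; congr (_ + _).
  by apply: eq_bigr => l _; rewrite !mxE.
- move=> i j im j0; rewrite raddfD /= (zigzag_first_row _ j0) add0r row_mul.
  have -> : row j (const_mx 1) = 1%:M :> 'M[R]_1.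
    by apply/matrixP => p k; rewrite !ord1 !mxE eqxx.
  by rewrite mul1mx; congr (row _ _); apply: val_inj; exact: (congr1 predn im).
Qed.

(** * Vertices of the pieces *)

Section PiecePoints.
Variables (R : realType) (d : nat) (t : 'I_d.+1 -> R) (a b : 'I_d -> R).
Hypothesis t_incr : forall i j : 'I_d.+1, (i < j)%N -> t i < t j.

Lemma breakpoint_inj : injective t.
Proof.
move=> i j tij; apply: val_inj.
by case: (ltngtP i j) => // /t_incr; rewrite tij ltxx.
Qed.

Lemma tleft_eq i j : tleft t i = tleft t j -> i = j.
Proof. by move=> /breakpoint_inj/(congr1 val) /= ij; apply: val_inj. Qed.

Lemma tright_eq i j : tright t i = tright t j -> i = j.
Proof. by move=> /breakpoint_inj/lift_inj. Qed.

Lemma tleft_tright_eq i j : tleft t i = tright t j -> i = j.+1 :> nat.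
Proof. by move=> /breakpoint_inj/(congr1 val). Qed.

Lemma mem_points x :
  (x \in points t a b) = [exists i, (x == lpoint t a b i) || (x == rpoint t a b i)].
Proof.
rewrite mem_undup; apply/flatten_mapP/existsP => [[i _]|[i xi]].
  by rewrite !inE; exists i.
by exists i; rewrite ?mem_enum ?inE.
Qed.

Lemma lpoint_points i : lpoint t a b i \in points t a b.
Proof. by rewrite mem_points; apply/existsP; exists i; rewrite eqxx. Qed.

Lemma rpoint_points i : rpoint t a b i \in points t a b.
Proof. by rewrite mem_points; apply/existsP; exists i; rewrite eqxx orbT. Qed.

(** The right endpoints have distinct abscissae, the first left endpoint precedes
    them all, and each jump adds the left endpoint of the piece that follows it,
    which differs in height from the right endpoint at the same abscissa. *)
Lemma leq_size_points : (0 < d)%N -> (d + 1 + kappa t a b <= size (points t a b))%N.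
Proof.
move=> d_gt0; pose i0 := Ordinal d_gt0; pose next (i : 'I_d) := insubd i0 i.+1.
have nextP i : discontinuous t a b i ->
    next i = i.+1 :> nat /\ lpoint t a b (next i) != rpoint t a b i.
  case/existsP => j /andP[/eqP ji jump].
  have -> : next i = j by apply: val_inj; rewrite val_insubd -ji ltn_ord.
  by split => //; apply: contra jump => /eqP[_ ->]; rewrite eqxx.
pose s := [seq rpoint t a b i | i <- enum 'I_d] ++
  lpoint t a b i0 :: [seq lpoint t a b (next i) | i <- enum (discontinuous t a b)].
have -> : (d + 1 + kappa t a b)%N = size s.
  rewrite size_cat size_map size_enum_ord /= size_map /kappa cardE.
  by rewrite addn1 addSnnS.
apply: uniq_leq_size => [|x]; last first.
  by rewrite mem_cat inE => /or3P[/mapP[i _ ->]|/eqP->|/mapP[i _ ->]];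
    rewrite ?rpoint_points ?lpoint_points.
rewrite /s cat_uniq cons_uniq map_inj_uniq; last by move=> i j [/tright_eq].
rewrite enum_uniq map_inj_in_uniq; last first.
  move=> i j; rewrite !mem_enum => /nextP[Ei _] /nextP[Ej _] [/tleft_eq Eij _].
  by apply: val_inj; apply: succn_inj; rewrite -Ei -Ej Eij.
rewrite enum_uniq andbT /=; apply/andP; split; last first.
  apply/mapP => -[i]; rewrite mem_enum => /nextP[Ei _] [/tleft_eq E0 _].
  by move: Ei; rewrite -E0.
rewrite negb_or; apply/andP; split.
  by apply/mapP => -[i _ [/tleft_tright_eq]].
apply/hasPn => _ /mapP[i + ->]; rewrite mem_enum => /nextP[Ei ne].
apply: contra ne => /mapP[j _ E]; have [/tleft_tright_eq Ej _] := E.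
rewrite E (_ : j = i) //; apply: val_inj; exact: succn_inj (etrans (esym Ej) Ei).
Qed.

Lemma piece_set_cover v : (0 < d)%N -> exists i, v \in piece_set t a b i.
Proof.
move=> d_gt0; have vs := leq_trans (ltn_ord v) (leq_size_points d_gt0).
have := mem_nth (0, 0) vs; rewrite mem_points => /existsP[i].
move=> xi; exists i; rewrite inE; case/orP: xi => /eqP <-;
  by rewrite index_uniq ?eqxx ?orbT ?undup_uniq.
Qed.

(** A vertex determines its abscissa, and a breakpoint is an end of at most two
    pieces. *)
Lemma piece_set_adjacent (i j : 'I_d) v : (i < j)%N ->
  v \in piece_set t a b i -> v \in piece_set t a b j -> j = i.+1 :> nat.
Proof.
have inj x y : x \in points t a b -> y \in points t a b ->
    v = index x (points t a b) :> nat -> v = index y (points t a b) :> nat ->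
    x.1 = y.1.
  by move=> xp yp -> E; rewrite (index_inj x xp yp E).
rewrite !inE => ij /orP[] /eqP Ei /orP[] /eqP Ej;
  have /= E := inj _ _ _ _ Ei Ej;
  move: (E ltac:(by rewrite ?lpoint_points ?rpoint_points)
           ltac:(by rewrite ?lpoint_points ?rpoint_points)) => {}E.
- by move: ij; rewrite (tleft_eq E) ltnn.
- by move: ij; rewrite (tleft_tright_eq E) ltnNge leqnSn.
- exact: tleft_tright_eq (esym E).
- by move: ij; rewrite (tright_eq E) ltnn.
Qed.

(** A vertex lies in one piece or in two consecutive ones, so its codes are
    either a single row or the two ends of one unit step. *)
Lemma piece_rows_parallel r (H : 'M[R]_(d, r)) v :
  (0 < r)%N -> unit_steps H ->
  exists k0, forall s s' k, v \in piece_set t a b s -> v \in piece_set t a b s' ->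
    k != k0 -> H s k = H s' k.
Proof.
move=> r_gt0 steps; pose P s := v \in piece_set t a b s.
have [[i j] /= /and3P[ij vi vj]|alone] :=
    pickP (fun q : 'I_d * 'I_d => [&& (q.1 < q.2)%N, P q.1 & P q.2]).
  have Ej := piece_set_adjacent ij vi vj.
  have onlyP s : P s -> s = i \/ s = j.
    move=> vs; case: (ltngtP s i) => [si|is_|/val_inj ->]; last by left.
      have Ei := piece_set_adjacent si vs vi.
      have := piece_set_adjacent (ltn_trans si ij) vs vj.
      by rewrite Ej Ei => /eqP; rewrite eqn_leq ltnn.
    have Es := piece_set_adjacent is_ vi vs.
    by right; apply: val_inj; rewrite /= Es Ej.
  have [k0 k0P] := steps i j Ej.
  exists k0 => s s' k /onlyP[]-> /onlyP[]-> // /k0P; first by [].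
  by move=> ->.
exists (Ordinal r_gt0) => s s' k vs vs' _; congr (H _ _).
apply: val_inj; case: (ltngtP s s') => // lt_ss'.
  by have := alone (s, s'); rewrite /= lt_ss' /P vs vs'.
by have := alone (s', s); rewrite /= lt_ss' /P vs vs'.
Qed.

End PiecePoints.

Theorem proposition3 (R : realType) (r : nat) (hr : (2 <= r)%N)
    (t : 'I_(2 ^ r).+1 -> R) (a b : 'I_(2 ^ r) -> R) (f : R -> R)
    (ht : forall i j : 'I_(2 ^ r).+1, (i < j)%N -> t i < t j)
    (hf : piecewise_linear t a b f)
    (hlsc : lsc_on_domain t f)
    (hcont :
      {in `[t (inord (2 ^ r %/ 4)), t (inord (2 ^ r %/ 2))], continuous f} \/
      {in `[t (inord (2 ^ r %/ 2)), t (inord ((3 * 2 ^ r) %/ 4))], continuous f})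
    (H : 'M[R]_(2 ^ r, r)) (hH : H = reflected_gray R r \/ H = zigzag R r)
    (lambda : 'rV[R]_(2 ^ r + 1 + kappa t a b)) (z : 'rV[R]_r) :
  embedding (piece_set t a b) H (lambda, z) <->
  (forall k : 'I_r,
     \sum_v lambda 0 v * min_over (fun s => v \in piece_set t a b s) (fun s => H s k)
       <= z 0 k
       <= \sum_v lambda 0 v * max_over (fun s => v \in piece_set t a b s) (fun s => H s k))
  /\ simplex lambda.
Proof.
have steps : unit_steps H.
  by case: hH => ->; [exact: unit_steps_reflected_gray|exact: unit_steps_zigzag].
have d_gt0 : (0 < 2 ^ r)%N by rewrite expn_gt0.
rewrite embedding_eq_box // => v; first exact: piece_set_cover.
exact: (piece_rows_parallel ht v (ltnW hr) steps).
Qed.
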